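(* Let $l=2$, $m\ge3$ and $0\le K\le\binom m2$. (i) If $d(K)>1.2m-1$, then the Schubert union $U$ of spanning dimension $K$ in $G(2,m)$ with minimal $M_U$ has, for all sufficiently large $q$, a maximal number of $F_q$-rational points among the Schubert unions in $G(2,m)$ of spanning dimension $K$. (ii) If $d(K)\le1.2m-5$, then the Schubert union $U$ of spanning dimension $K$ in $G(2,m)$ with maximal $M_U$ has, for all sufficiently large $q$, a maximal number of $F_q$-rational points among the Schubert unions in $G(2,m)$ of spanning dimension $K$.
   Context: Let $V$ be an $m$-dimensional vector space with basis $e_1,\dots,e_m$ and $A_i=\mathrm{Span}(e_1,\dots,e_i)$; $G(2,m)$ is the Grassmann variety of $2$-dimensional subspaces of $V$. Let $G_{G(2,m)}=\{(x,y)\in\mathbf Z^2:1\le x<y\le m\}$. For $(a,b)\in G_{G(2,m)}$ the Schubert cycle is $S_{(a,b)}=\{W:\dim(W\cap A_a)\ge1,\ W\subset A_b\}$, with grid $G_{(a,b)}=\{(x,y)\in G_{G(2,m)}:x\le a,y\le b\}$ and Krull dimension $a+b-3$. A Schubert union $U=S_U$ is a finite (possibly empty) union of Schubert cycles $S_{\alpha_i}$, with grid $G_U=\bigcup_iG_{\alpha_i}$. Its spanning dimension is the dimension of the linear span of its affine cone in the Plücker embedding, and equals $|G_U|$. Its number of $F_q$-rational points is $g_U(q)=\sum_{(x,y)\in G_U}q^{x+y-3}$, and its Krull dimension is $\deg g_U$. $d(K)$ denotes the maximal Krull dimension of the Schubert unions of spanning dimension $K$. $M_U=\{m_1>m_2>\dots>m_r\}\subset\{1,\dots,m-1\}$,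 where $m_i\ge1$ is the number of points of $G_U$ with $x=i$ for $i=1,\dots,r$, and there are no points with $x>r$. Schubert unions of spanning dimension $K$ are ordered with respect to $M_U$: $U>V$ if the largest element of $M_U$ is larger than that of $M_V$, or if these are equal and the second largest element is larger, and so on; ''minimal/maximal $M_U$'' refers to this order. *)

(* Defs.v *)
From HB Require Import structures.
From mathcomp Require Import all_boot all_order all_algebra.
From mathcomp Require Import classical_sets.

Set Implicit Arguments.
Unset Strict Implicit.
Unset Printing Implicit Defensive.

Import Order.TTheory GRing.Theory Num.Theory.
Import VectorInternalTheory.
Local Open Scope ring_scope.

(** Pairs [(x, y)] with [1 <= x < y <= m]; the coordinates in ['I_m.+1] are used
    1-based, so that [y <= m] is automatic. *)
Definition grid (m : nat) : Type :=
  {p : 'I_m.+1 * 'I_m.+1 | (0 < p.1 < p.2)%N}.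

Definition gx m (p : grid m) : nat := (val p).1.
Definition gy m (p : grid m) : nat := (val p).2.

Definition grid_of_cycle m (a : grid m) : {set grid m} :=
  [set p | (gx p <= gx a)%N && (gy p <= gy a)%N].

(** A Schubert union is given by the finite set [U] of the indices of its
    Schubert cycles. Two index sets can present the same union, but everything
    below depends only on the union. *)
Definition grid_of m (U : {set grid m}) : {set grid m} :=
  \bigcup_(a in U) grid_of_cycle a.

Section Geometry.
Variables (F : fieldType) (m : nat).
Implicit Types (W : {vspace 'rV[F]_m}) (a : grid m) (U : {set grid m}).

(** [A_i = Span(e_1, ..., e_i)]; the vector [e_(j+1)] is [delta_mx 0 j]. *)
Definition flag (i : nat) : {vspace 'rV[F]_m} :=
  <<[seq (delta_mx 0 j : 'rV[F]_m)%R | j : 'I_m <- enum 'I_m & (j < i)%N]>>%VS.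

Definition in_G2 W : bool := \dim W == 2%N.

Definition in_cycle a W : bool :=
  [&& in_G2 W, (1 <= \dim (W :&: flag (gx a)))%N & (W <= flag (gy a))%VS].

Definition in_union U W : bool := [exists a in U, in_cycle a W].

(** [u ∧ v], as the alternating matrix of the 2 x 2 minors of [(u, v)]. *)
Definition wedge (u v : 'rV[F]_m) : 'M[F]_m := u^T *m v - v^T *m u.

(** A scalar multiple of [u ∧ v] is [(c *: u) ∧ v], and [u ∧ v = 0] if [u] and
    [v] are dependent: this is the whole affine cone over the Plücker image. *)
Definition affine_cone U : set 'M[F]_m :=
  fun w => exists W u v, [/\ in_union U W, u \in W, v \in W & w = wedge u v].

End Geometry.

Definition is_linear_span (F : fieldType) (vT : vectType F)
    (P : set vT) (L : {vspace vT}) : Prop :=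
  (forall w, P w -> w \in L) /\
  (forall L' : {vspace vT}, (forall w, P w -> w \in L') -> (L <= L')%VS).

Definition linear_span (F : fieldType) (vT : vectType F) (P : set vT) :
    {vspace vT} :=
  xget 0%VS (is_linear_span P).

(** The ground field [k] is immaterial: the dimension is [#|grid_of U|]. *)
Definition spanning_dim (k : fieldType) m (U : {set grid m}) : nat :=
  \dim (linear_span (@affine_cone k m U)).

HB.instance Definition _ (F : finFieldType) (vT : vectType F) :=
  [Countable of {vspace vT} by <:].
HB.instance Definition _ (F : finFieldType) (vT : vectType F) :=
  [Finite of {vspace vT} by <:].

Definition num_points (F : finFieldType) m (U : {set grid m}) : nat :=
  #|[set W : {vspace 'rV[F]_m} | in_union U W]|.

Definition gpoly m (U : {set grid m}) : {poly int} :=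
  \sum_(p in grid_of U) 'X^(gx p + gy p - 3).

(** The degree of the point-counting polynomial; [-1] for the empty union. *)
Definition krull_dim m (U : {set grid m}) : int := (size (gpoly U))%:Z - 1.

(** [-1] is the least value of [krull_dim]. *)
Definition max_krull_dim (k : fieldType) (m K : nat) : int :=
  \big[Order.max/-1]_(U : {set grid m} | spanning_dim k U == K) krull_dim U.

Definition column_size m (U : {set grid m}) (i : nat) : nat :=
  #|[set p in grid_of U | gx p == i]|.

(** The column sizes are strictly decreasing in [x] until they vanish, so this
    lists the set [M_U = {m_1 > ... > m_r}] in decreasing order, and the order on
    [M_U] is the lexicographic order of these sequences. *)
Definition M_seq m (U : {set grid m}) : seqlexi nat :=
  [seq n <- [seq column_size U i | i <- iota 1 m] | (0 < n)%N].

Definition has_minimal_M (k : fieldType) m (K : nat) (U : {set grid m}) : Prop :=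
  spanning_dim k U = K /\
  forall V : {set grid m}, spanning_dim k V = K -> (M_seq U <= M_seq V)%O.

Definition has_maximal_M (k : fieldType) m (K : nat) (U : {set grid m}) : Prop :=
  spanning_dim k U = K /\
  forall V : {set grid m}, spanning_dim k V = K -> (M_seq V <= M_seq U)%O.

Definition eventually_max_points (k : fieldType) m (K : nat)
    (U : {set grid m}) : Prop :=
  exists q0 : nat, forall F : finFieldType, (q0 <= #|F|)%N ->
    forall V : {set grid m}, spanning_dim k V = K ->
      (num_points F V <= num_points F U)%N.

(* Main.v *)
Require Import Defs.
From mathcomp Require Import all_boot all_order all_algebra.
From mathcomp Require Import zify ring lra.
From mathcomp Require classical_sets.
Local Open Scope ring_scope.

(** Both numbers attached to a Schubert union depend only on its grid. The
    Pluecker coordinates that do not vanish on the affine cone are those indexed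
    by the grid, whence the spanning dimension ([spanning_dimE]); planes have
    unique reduced bases, and counting these by the positions of their pivots
    gives the number of points as the sum of [q ^ (x + y - 3)] over the grid
    ([num_pointsE]). So the problem is to maximise this sum, for large [q], among
    the down-closed sets of [K] grid points. Call [x + y - 3] the level of a point.

    The minimal [M_U] is attained by one grid only, the one filled row by row, and
    the maximal [M_U] by the one filled column by column: another down-closed set
    of the same size is on the wrong side in the first column where it differs,
    since otherwise one of the two sets would contain the other
    ([row_initial_first], [col_initial_first]).

    Each of these extremal grids [C] consists of a full part [R] (a triangle
    [y <= a + 1], or the first [r] columns) and of [e] more points in one line, one
    on each of [e] consecutive levels. A down-closed set [D] of [K] points that
    contains [R] is never better than [C], for any [q >= 1]: from each point of
    [D] outside [R] one can step down one level at a time to the lowest level, so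
    that the [k]-th lowest point is not above the [k]-th point of the line
    ([graded_sum_le]). A set [D] that does not reach the top level of [C] loses as
    soon as [q >= K], by comparing leading terms ([top_level_le]).

    The hypothesis on the Krull dimension is used for the sets [D] that reach the
    top level without containing [R]. The rectangle below [(x, y)] has
    [x y - x (x + 1) / 2] points. On an antidiagonal [x + y = s] this is concave in
    [x], so it is smallest at one of the ends, which are near [y = x + 1] and at
    [y = m]; the values at the two ends agree when [s = 6 m / 5], and this is the
    origin of the number 1.2. Above the threshold the first end is the smaller
    one, and the triangle is the cheapest way to reach the top level; below it the
    first columns are. Away from the cheap end the rectangle has more than [K]
    points ([row_top_points], [col_top_points]). The only exceptions are points
    next to the cheap end, where the points of [R] missing from [D] can be traded
    for points of [D] on the same levels ([exchange_le]), and one single set for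
    [m = 9], [K = 26], which has too few points on the top level. *)

Set Implicit Arguments.
Unset Strict Implicit.
Unset Printing Implicit Defensive.

Import Order.TTheory GRing.Theory Num.Theory.

(** * Flags, planes and the Pluecker span *)

Lemma grid_range m (p : grid m) : (0 < gx p < gy p)%N /\ (gy p <= m)%N.
Proof. by case: p => -[x y] /= H; split=> //; rewrite /gy /= -ltnS. Qed.

Lemma grid_eq m (p q : grid m) : gx p = gx q -> gy p = gy q -> p = q.
Proof.
by case: p q => [[x y] h] [[x' y'] h'] ex ey; apply/val_inj; congr pair; apply: val_inj.
Qed.

Lemma mem_flag (F : fieldType) m (i : nat) (u : 'rV[F]_m) :
  reflect (forall j : 'I_m, (i <= j)%N -> u 0 j = 0) (u \in flag F m i).
Proof.
apply: (iffP idP) => [uA j ij|u0].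
  rewrite (coord_span (X := in_tuple _) uA) summxE big1 // => l _; rewrite !mxE.
  set X := in_tuple _; have : X`_l \in X by rewrite mem_nth // size_tuple.
  case/mapP=> j'; rewrite mem_filter => /andP[j'i _] ->.
  rewrite mxE eqxx /=; case: eqP => [jj'|]; last by rewrite mulr0.
  by move: ij; rewrite jj' leqNgt j'i.
rewrite [u]row_sum_delta; apply: memv_suml => j _.
case: (ltnP j i) => ji; last by rewrite u0 ?scale0r ?mem0v.
apply/memvZ/memv_span/mapP; exists j => //.
by rewrite mem_filter ji mem_enum.
Qed.

Lemma span_pairP (F : fieldType) (vT : vectType F) (u v w : vT) :
  reflect (exists a b, w = a *: u + b *: v) (w \in <<[:: u; v]>>%VS).
Proof.
rewrite span_cons span_seq1; apply: (iffP memv_addP) => [[_ /vlineP[a ->] [_ /vlineP[b ->] ->]]|[a [b ->]]].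
  by exists a, b.
by exists (a *: u); rewrite ?memvZ ?memv_line //; exists (b *: v); rewrite ?memvZ ?memv_line.
Qed.

Lemma free_pair_span (F : fieldType) (vT : vectType F) (W : {vspace vT}) (u v : vT) :
  \dim W = 2%N -> u \in W -> v \in W -> free [:: u; v] -> <<[:: u; v]>>%VS = W.
Proof.
move=> dW uW vW fr; apply/eqP; rewrite eqEdim (eqP fr) dW leqnn andbT.
by apply/span_subvP => z; rewrite !inE => /orP[] /eqP->.
Qed.

(** In a Schubert cycle [w] is a vector of [W] in the smaller flag subspace; what
    matters is that the relation involves [u] or [v], so that a nontrivial combination of the two
    lies on the line of [w]. *)
Lemma dependent_in_plane (F : fieldType) (vT : vectType F) (W : {vspace vT}) (u v w : vT) :
  \dim W = 2%N -> u \in W -> v \in W -> w \in W -> w != 0 ->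
  exists a b c, (a, b) != (0, 0) /\ a *: u + b *: v = c *: w.
Proof.
move=> dW uW vW wW w0; have [fr|] := boolP (free [:: u; v]).
  move: wW; rewrite -(free_pair_span dW uW vW fr) => /span_pairP[a [b e]].
  exists a, b, 1; rewrite scale1r; split=> //.
  by apply: contraNneq w0 => -[a0 b0]; rewrite e a0 b0 !scale0r addr0.
rewrite free_cons seq1_free span_seq1 negb_and !negbK => /orP[/vlineP[k ->]|/eqP->].
  by exists 1, (- k), 0; rewrite xpair_eqE oner_eq0 scaleNr !scale1r subrr scale0r.
by exists 0, 1, 0; rewrite xpair_eqE oner_eq0 andbF !scale0r scaler0 addr0.
Qed.

Lemma wedgeE (F : fieldType) m (u v : 'rV[F]_m) i j :
  wedge u v i j = u 0 i * v 0 j - v 0 i * u 0 j.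
Proof. by rewrite !mxE !big_ord1 !mxE. Qed.

(** If column [j] lies beyond [A_(gy a)], both entries there vanish. If column [i]
    lies beyond [A_(gx a)], so does [j], and a nontrivial combination of [u] and
    [v] lying in [A_(gx a)] is a linear relation between the rows of the minor. *)
Lemma cycle_minor_eq0 (F : fieldType) m (a : grid m) (W : {vspace 'rV[F]_m}) u v (i j : 'I_m) :
  in_cycle a W -> u \in W -> v \in W -> (i < j)%N ->
  ~~ ((i < gx a) && (j < gy a))%N -> wedge u v i j = 0.
Proof.
case/and3P=> /eqP dW; rewrite lt0n dimv_eq0 -vpick0; set w := vpick _ => w0 Wy uW vW ij.
have : w \in (W :&: flag F m (gx a))%VS by apply: memv_pick.
rewrite memv_cap => /andP[wW /mem_flag wx].
rewrite negb_and -!leqNgt wedgeE => /orP[ai|aj]; last first.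
  have /mem_flag uy := subvP Wy _ uW; have /mem_flag vy := subvP Wy _ vW.
  by rewrite (uy j aj) (vy j aj) !mulr0 subrr.
have [al [be [c [ab0 e]]]] := dependent_in_plane dW uW vW wW w0.
have ei (l : 'I_m) : (gx a <= l)%N -> al * u 0 l + be * v 0 l = 0.
  by move=> /wx wl; move/matrixP/(_ 0 l): e; rewrite !mxE wl mulr0.
have e1 := ei i ai; have e2 := ei j (leq_trans ai (ltnW ij)).
move: ab0; rewrite xpair_eqE negb_and => /orP[al0|be0].
  apply: (mulfI al0); rewrite mulr0.
  have -> : al * (u 0 i * v 0 j - v 0 i * u 0 j) = (al * u 0 i + be * v 0 i) * v 0 j - v 0 i * (al * u 0 j + be * v 0 j) by ring.
  by rewrite e1 e2; ring.
apply: (mulfI be0); rewrite mulr0.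
have -> : be * (u 0 i * v 0 j - v 0 i * u 0 j) = (al * u 0 j + be * v 0 j) * u 0 i - u 0 j * (al * u 0 i + be * v 0 i) by ring.
by rewrite e1 e2; ring.
Qed.

Lemma ordx_subproof m (p : grid m) : ((gx p).-1 < m)%N.
Proof. have [] := grid_range p; lia. Qed.
Lemma ordy_subproof m (p : grid m) : ((gy p).-1 < m)%N.
Proof. have [] := grid_range p; lia. Qed.
(** Coordinates of grid points are 1-based, indices of matrix columns 0-based. *)
Definition ordx m (p : grid m) : 'I_m := Ordinal (ordx_subproof p).
Definition ordy m (p : grid m) : 'I_m := Ordinal (ordy_subproof p).

Lemma ordx_lt_ordy m (p : grid m) : (ordx p < ordy p)%N.
Proof. by have [] := grid_range p => /=; lia. Qed.

Lemma exists_point m x y : (0 < x < y)%N -> (y <= m)%N ->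
  exists p : grid m, gx p = x /\ gy p = y.
Proof.
move=> xy ym; have xm : (x < m.+1)%N by lia.
by exists (@exist _ _ (Ordinal xm, Ordinal (ym : (y < m.+1)%N)) xy).
Qed.

Definition unit_wedge (F : fieldType) m (p : grid m) : 'M[F]_m :=
  wedge (delta_mx 0 (ordx p)) (delta_mx 0 (ordy p)).

Lemma ord_grid_eq m (p q : grid m) : (p == q) = (ordx p == ordx q) && (ordy p == ordy q).
Proof.
apply/eqP/andP => [->//|[/eqP/(congr1 val) /= ex /eqP/(congr1 val) /= ey]].
by have [] := grid_range p; have [] := grid_range q; move=> *; apply: grid_eq; lia.
Qed.

Lemma unit_wedge_entry (F : fieldType) m (p : grid m) (i j : 'I_m) : (i < j)%N ->
  unit_wedge F p i j = ((ordx p == i) && (ordy p == j))%:R.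
Proof.
move=> ij; rewrite /unit_wedge wedgeE !mxE !eqxx /= -!natrM !mulnb.
rewrite (eq_sym (ordx p)) (eq_sym (ordy p)).
have -> : (i == ordy p) && (j == ordx p) = false; last by rewrite subr0.
have := ordx_lt_ordy p; apply: contraTF => /andP[/eqP <- /eqP<-]; lia.
Qed.

Lemma unit_wedge_free (F : fieldType) m (s : seq (grid m)) : uniq s ->
  free [seq unit_wedge F p | p <- s].
Proof.
move=> us; rewrite -[X in free X]in_tupleE; apply/freeP => k k0 i.
have is_ : (i < size s)%N by rewrite -(size_map (@unit_wedge F m)).
pose p1 := tnth (in_tuple s) (Ordinal is_); pose p0 := nth p1 s i.
have := congr1 (fun M : 'M_m => M (ordx p0) (ordy p0)) k0.
rewrite summxE mxE (bigD1 i) //= big1 => [|j ji].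
  by rewrite addr0 mxE (nth_map p1) // unit_wedge_entry ?ordx_lt_ordy // !eqxx mulr1.
have js : (j < size s)%N by rewrite -(size_map (@unit_wedge F m)).
rewrite mxE (nth_map p1) // unit_wedge_entry ?ordx_lt_ordy // -ord_grid_eq.
by rewrite nth_uniq // val_eqE (negPf ji) mulr0.
Qed.

Lemma mem_grid_of m (U : {set grid m}) p :
  reflect (exists2 a, a \in U & (gx p <= gx a)%N && (gy p <= gy a)%N) (p \in grid_of U).
Proof. by apply: (iffP bigcupP) => -[a aU]; rewrite ?inE => h; exists a; rewrite ?inE. Qed.

(** An alternating matrix is determined by its entries above the diagonal. *)
Lemma wedge_mem_span (F : fieldType) m (G : {set grid m}) (u v : 'rV[F]_m) :
  (forall i j : 'I_m, (i < j)%N -> wedge u v i j != 0 ->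
     exists2 p, p \in G & ordx p = i /\ ordy p = j) ->
  wedge u v \in <<[seq unit_wedge F p | p <- enum G]>>%VS.
Proof.
move=> H.
have scE (c : F) (A : 'M[F]_m) i j : (c *: A) i j = c * A i j by rewrite mxE.
have -> : wedge u v = \sum_(p in G) wedge u v (ordx p) (ordy p) *: unit_wedge F p.
  have up (i j : 'I_m) : (i < j)%N ->
     wedge u v i j = (\sum_(p in G) wedge u v (ordx p) (ordy p) *: unit_wedge F p) i j.
    move=> ij; rewrite summxE.
    have [p /andP[pG /andP[/eqP ei /eqP ej]]|none] := pickP [pred p in G | (ordx p == i) && (ordy p == j)].
      rewrite (bigD1 p) //= big1 => [|q /andP[_ qp]].
        by rewrite scE unit_wedge_entry ?ei ?ej ?eqxx ?mulr1 ?addr0.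
      by rewrite scE unit_wedge_entry // -ei -ej -ord_grid_eq (negPf qp) mulr0.
    rewrite big1 => [|q qG].
      apply/eqP/negP => /negP /(H i j ij)[p pG [ei ej]].
      by have := none p; rewrite /= pG ei ej !eqxx.
    rewrite scE unit_wedge_entry //; have := none q; rewrite /= qG /= => ->.
    by rewrite mulr0.
  have anti (x y : 'rV[F]_m) i j : wedge x y i j = - wedge x y j i.
    by rewrite !wedgeE; ring.
  apply/matrixP => i j; case: (ltngtP i j) => [/up //|ji|/val_inj ->].
    rewrite anti up // !summxE -sumrN; apply: eq_bigr => p _.
    by rewrite !scE [unit_wedge F p i j]anti mulrN.
  have diag0 (x y : 'rV[F]_m) l : wedge x y l l = 0 by rewrite wedgeE mulrC subrr.
  by rewrite diag0 summxE big1 // => p _; rewrite scE diag0 mulr0.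
apply: memv_suml => p pG; apply/memvZ/memv_span/map_f; by rewrite mem_enum.
Qed.

Lemma delta_pair_free (F : fieldType) m (i j : 'I_m) : i != j ->
  free [:: (delta_mx 0 i : 'rV[F]_m); delta_mx 0 j].
Proof.
move=> ij; rewrite free_cons seq1_free span_seq1; apply/andP; split.
  apply/negP => /vlineP[k /matrixP/(_ 0 i)].
  by rewrite !mxE !eqxx (negPf ij) mulr0 => /eqP; rewrite oner_eq0.
by apply/eqP => /matrixP/(_ 0 j); rewrite !mxE !eqxx => /eqP; rewrite oner_eq0.
Qed.

Lemma in_cycle_span (F : fieldType) m (a : grid m) (x y : nat) (u v : 'rV[F]_m) :
  (x <= gx a)%N -> (y <= gy a)%N -> u \in flag F m x -> v \in flag F m y ->
  (x <= y)%N -> free [:: u; v] -> in_cycle a <<[:: u; v]>>%VS.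
Proof.
move=> xa ya uA vA xy fr; apply/and3P; split; first by rewrite /in_G2 (eqP fr).
  rewrite lt0n dimv_eq0; apply/negP => /eqP cap0.
  suff: u \in (0 : {vspace 'rV[F]_m})%VS.
    by rewrite memv0; apply/negP; apply: (free_not0 fr); rewrite mem_head.
  rewrite -cap0 memv_cap memv_span ?mem_head //=; apply/mem_flag => j aj.
  by move/mem_flag: uA; apply; lia.
apply/span_subvP => z; rewrite !inE => /orP[]/eqP->; apply/mem_flag => j aj.
  by move/mem_flag: uA; apply; lia.
by move/mem_flag: vA; apply; lia.
Qed.

Lemma linear_spanE (F : fieldType) (vT : vectType F) (P : classical_sets.set vT) (L : {vspace vT}) :
  is_linear_span P L -> linear_span P = L.
Proof.
move=> PL; have [P1 P2] := classical_sets.xgetPex 0%VS (ex_intro _ L PL); case: PL => L1 L2.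
by apply/eqP; rewrite eqEsubv P2 // L2.
Qed.

(** The span has the basis of the matrices [unit_wedge p], [p] in the grid: each of
    them comes from the coordinate plane at [p], which belongs to the union, and
    every other Pluecker coordinate vanishes on the cone by [cycle_minor_eq0]. *)
Lemma spanning_dimE (k : fieldType) m (U : {set grid m}) :
  spanning_dim k U = #|grid_of U|.
Proof.
rewrite /spanning_dim (linear_spanE (L := <<[seq unit_wedge k p | p <- enum (grid_of U)]>>%VS)).
  by rewrite (eqP (unit_wedge_free k (enum_uniq _))) size_map -cardE.
split=> [w [W [u [v [/existsP[a /andP[aU aW]] uW vW ->]]]]|L' coneL].
  apply: wedge_mem_span => i j ij nz.
  have /andP[ia ja] : (i < gx a)%N && (j < gy a)%N.
    by apply: contraNT nz => h; rewrite (cycle_minor_eq0 aW).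
  have [|p [ex ey]] := @exists_point m i.+1 j.+1 ij; first exact: ltn_ord.
  exists p; last by split; apply: val_inj; rewrite /= ?ex ?ey.
  by apply/mem_grid_of; exists a => //; rewrite ex ey ia.
apply/span_subvP => _ /mapP[p + ->]; rewrite mem_enum => /mem_grid_of[a aU /andP[xa ya]].
have [xy ym] := grid_range p; have ltp := ordx_lt_ordy p.
apply: coneL; exists <<[:: (delta_mx 0%R (ordx p) : 'rV[k]_m); delta_mx 0%R (ordy p)]>>%VS.
exists (delta_mx 0 (ordx p)), (delta_mx 0 (ordy p)); split=> //.
- apply/existsP; exists a; rewrite aU /=; apply: (in_cycle_span xa ya).
  + by apply/mem_flag => j ja; rewrite mxE eqxx -val_eqE /=; case: eqP => //; lia.
  + by apply/mem_flag => j ja; rewrite mxE eqxx -val_eqE /=; case: eqP => //; lia.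
  + lia.
  + by apply: delta_pair_free; rewrite -val_eqE neq_ltn ltp.
- by apply: memv_span; rewrite mem_head.
- by apply: memv_span; rewrite !inE eqxx orbT.
Qed.

(** * Counting points by reduced bases *)

Definition agreeing (F : finFieldType) m (S : {set 'I_m}) (w : 'rV[F]_m) :=
  [set u : 'rV[F]_m | [forall i in S, u 0 i == w 0 i]].

Lemma agreeingP (F : finFieldType) m (S : {set 'I_m}) (w u : 'rV[F]_m) :
  reflect (forall i, i \in S -> u 0 i = w 0 i) (u \in agreeing S w).
Proof. by rewrite inE; apply: (iffP forall_inP) => H i iS; apply/eqP/H. Qed.

Lemma card_agreeing (F : finFieldType) m (S : {set 'I_m}) (w : 'rV[F]_m) :
  #|agreeing S w| = (#|F| ^ #|~: S|)%N.
Proof.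
pose A i : {pred F} := if i \in S then pred1 (w 0 i) else predT.
have -> : agreeing S w = [set \row_i (f : {ffun 'I_m -> F}) i | f in (family A : {pred {ffun 'I_m -> F}})].
  apply/setP => u; apply/agreeingP/imsetP => [H|[f /familyP fA ->] i iS].
    exists [ffun i => u 0 i]; last by apply/rowP => i; rewrite mxE ffunE.
    by apply/familyP => i; rewrite ffunE /A; case: ifP => // /H /eqP.
  by have := fA i; rewrite mxE /A iS => /eqP.
rewrite card_imset => [|f g /rowP e]; last by apply/ffunP => i; have := e i; rewrite !mxE.
rewrite card_family foldrE big_map big_enum /= (bigID [in S]) /= big1 ?mul1n => [|i iS]; last by rewrite /A iS card1.
rewrite (eq_bigr (fun=> #|F|)) => [|i iS]; last by rewrite /A (negPf iS).
by rewrite prod_nat_const; congr expn; apply: eq_card => i; rewrite inE.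
Qed.

Lemma card_ord_lt m x : (x <= m)%N -> #|[set i : 'I_m | (i < x)%N]| = x.
Proof.
move=> xm; rewrite -sum1dep_card -[RHS]muln1 -[in RHS](subn0 x) -sum_nat_const_nat.
by rewrite -(big_ord_widen _ (fun=> 1%N) xm) big_mkord.
Qed.

(** Bases in reduced echelon form with pivots at [gx p] and [gy p], pivots being
    last nonzero entries: [u] ends with a 1 at [gx p], [v] ends with a 1 at [gy p]
    and has a 0 at [gx p]. *)
Definition reduced_pairs (F : finFieldType) m (p : grid m) : {set 'rV[F]_m * 'rV[F]_m} :=
  setX (agreeing [set i : 'I_m | (ordx p <= i)%N] (delta_mx 0 (ordx p)))
       (agreeing [set i : 'I_m | (ordy p <= i)%N || (i == ordx p)] (delta_mx 0 (ordy p))).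

Lemma reducedP (F : finFieldType) m (p : grid m) (u v : 'rV[F]_m) :
  reflect [/\ u \in flag F m (gx p), v \in flag F m (gy p),
    u 0 (ordx p) = 1, v 0 (ordy p) = 1 & v 0 (ordx p) = 0] ((u, v) \in reduced_pairs F p).
Proof.
have [xy ym] := grid_range p; have ltp := ordx_lt_ordy p.
rewrite in_setX; apply: (iffP andP) => [[/agreeingP Hu /agreeingP Hv]|[/mem_flag Hu /mem_flag Hv ux vy vx]].
  split.
  - apply/mem_flag=> j jx; rewrite Hu ?inE ?mxE ?eqxx -?val_eqE /=; last by lia.
    by case: eqP => //; lia.
  - apply/mem_flag=> j jx; rewrite Hv ?inE ?mxE ?eqxx -?val_eqE /=; last by lia.
    by case: eqP => //; lia.
  - by rewrite Hu ?inE // mxE !eqxx.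
  - by rewrite Hv ?inE ?leqnn // mxE !eqxx.
  - rewrite Hv ?inE ?eqxx ?orbT // mxE eqxx -val_eqE /=.
    by case: eqP => //; lia.
split; apply/agreeingP => i; rewrite inE mxE eqxx /=.
  have [->|ne] := eqVneq i (ordx p) => // h; rewrite Hu //; move: ne h; rewrite -val_eqE /=; lia.
have [-> _|nx] := eqVneq i (ordx p).
  by rewrite vx; case: eqP => // e; move: ltp; rewrite e ltnn.
rewrite orbF; have [->|ne] := eqVneq i (ordy p) => // h; rewrite Hv //; move: ne h; rewrite -val_eqE /=; lia.
Qed.

Definition wt m (p : grid m) : nat := (gx p + gy p - 3)%N.

(** The free entries are the [gx p - 1] entries of [u] and the [gy p - 2] entries
    of [v] before their pivots. *)
Lemma card_reduced_pairs (F : finFieldType) m (p : grid m) :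
  #|reduced_pairs F p| = (#|F| ^ wt p)%N.
Proof.
have [xy ym] := grid_range p; have ltp := ordx_lt_ordy p.
rewrite cardsX !card_agreeing -expnD /wt; congr expn.
have -> : ~: [set i : 'I_m | (ordx p <= i)%N] = [set i : 'I_m | (i < ordx p)%N].
  by apply/setP => i; rewrite !inE ltnNge.
have -> : ~: [set i : 'I_m | (ordy p <= i)%N || (i == ordx p)] = [set i : 'I_m | (i < ordy p)%N] :\ ordx p.
  by apply/setP => i; rewrite !inE negb_or ltnNge andbC.
have := cardsD1 (ordx p) [set i : 'I_m | (i < ordy p)%N].
rewrite !card_ord_lt; [|by apply: ltnW|by apply: ltnW].
rewrite inE ltp [nat_of_bool _]/=; set c := #|_| => /= ec; lia.
Qed.

Lemma reduced_free (F : finFieldType) m (p : grid m) (u v : 'rV[F]_m) :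
  (u, v) \in reduced_pairs F p -> free [:: u; v].
Proof.
case/reducedP => _ _ ux vy vx; rewrite free_cons seq1_free span_seq1; apply/andP; split.
  apply/negP => /vlineP[k e]; move: ux; rewrite e mxE vx mulr0 => /eqP.
  by rewrite eq_sym oner_eq0.
by apply: contraPneq vy => ->; rewrite mxE => /eqP; rewrite eq_sym oner_eq0.
Qed.

Lemma reduced_span_le (F : finFieldType) m (p q : grid m) (u v u' v' : 'rV[F]_m) :
  (u, v) \in reduced_pairs F p -> (u', v') \in reduced_pairs F q ->
  v' \in <<[:: u; v]>>%VS -> (gy q <= gy p)%N.
Proof.
case/reducedP => /mem_flag uA /mem_flag vA ux vy vx /reducedP [_ _ ux' vy' vx'] /span_pairP[a [b e]].
rewrite leqNgt; apply/negP => lt; move: vy'; rewrite e !mxE uA ?vA.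
- by rewrite !mulr0 addr0 => /eqP; rewrite eq_sym oner_eq0.
- by rewrite /=; lia.
- by rewrite /=; have [] := grid_range p; lia.
Qed.

(** The larger pivot is the largest position of a nonzero entry in the plane, so it
    agrees for both bases. Then [u'] has a 0 there, which makes it a multiple of
    [u], and the normalizations at the two pivots determine everything. *)
Lemma reduced_unique (F : finFieldType) m (p q : grid m) (u v u' v' : 'rV[F]_m) :
  (u, v) \in reduced_pairs F p -> (u', v') \in reduced_pairs F q ->
  <<[:: u; v]>>%VS = <<[:: u'; v']>>%VS -> [/\ p = q, u = u' & v = v'].
Proof.
move=> uv uv' e.
have ey : gy p = gy q.
  apply/eqP; rewrite eqn_leq (reduced_span_le uv' uv) ?(reduced_span_le uv uv') //.
    by rewrite e memv_span // !inE eqxx orbT.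
  by rewrite -e memv_span // !inE eqxx orbT.
have eoy : ordy p = ordy q by apply: val_inj; rewrite /= ey.
have /span_pairP[a [b eu]] : u' \in <<[:: u; v]>>%VS by rewrite e memv_span ?mem_head.
have /span_pairP[c [d ev]] : v' \in <<[:: u; v]>>%VS by rewrite e memv_span ?inE ?eqxx ?orbT.
have [/mem_flag uA /mem_flag vA ux vy vx] := reducedP _ _ _ uv.
have [/mem_flag uA' /mem_flag vA' ux' vy' vx'] := reducedP _ _ _ uv'.
have [xy ym] := grid_range p; have [xy' ym'] := grid_range q.
have uy : u 0 (ordy p) = 0 by apply: uA => /=; lia.
have uy' : u' 0 (ordy p) = 0 by rewrite eoy; apply: uA' => /=; lia.
have b0 : b = 0 by move: uy'; rewrite eu !mxE uy vy mulr0 mulr1 add0r.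
have {}eu : u' = a *: u by rewrite eu b0 scale0r addr0.
have a0 : a != 0.
  apply: contraPneq ux' => a0; rewrite eu a0 scale0r mxE => /eqP.
  by rewrite eq_sym oner_eq0.
have ex : gx p = gx q.
  apply/eqP; rewrite eqn_leq; apply/andP; split; rewrite leqNgt; apply/negP => lt.
    have /eqP : u' 0 (ordx p) = 0 by apply: uA' => /=; lia.
    by rewrite eu mxE ux mulr1 (negPf a0).
  have /eqP : u 0 (ordx q) = 0 by apply: uA => /=; lia.
  move: ux'; rewrite eu mxE => h /eqP u0; move: h; rewrite u0 mulr0 => /eqP.
  by rewrite eq_sym oner_eq0.
have epq := grid_eq ex ey; subst q.
have a1 : a = 1 by move: ux'; rewrite eu mxE ux mulr1.
have d1 : d = 1 by move: vy'; rewrite ev !mxE uy vy mulr0 mulr1 add0r.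
have c0 : c = 0 by move: vx'; rewrite ev !mxE ux vx mulr0 mulr1 addr0.
by rewrite eu ev a1 d1 c0 !scale1r scale0r add0r.
Qed.

(** Position of the last nonzero entry, counted from 1, and 0 for the zero vector:
    the least [i] with [u] in [A_i]. *)
Definition lead (F : fieldType) m (u : 'rV[F]_m) : nat :=
  \max_(i : 'I_m | u 0 i != 0) i.+1.

Lemma lead_flag (F : fieldType) m (u : 'rV[F]_m) i :
  (u \in flag F m i) = (lead u <= i)%N.
Proof.
apply/mem_flag/bigmax_leqP => H j h.
  by rewrite leqNgt ltnS; apply: contra h => ij; rewrite H.
by apply/eqP; apply: contraTT h => /H; rewrite -ltnNge.
Qed.

Lemma lead_coord (F : fieldType) m (u : 'rV[F]_m) : u != 0 ->
  exists2 i : 'I_m, lead u = i.+1 & u 0 i != 0.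
Proof.
move=> u0; have : (0 < #|[pred i : 'I_m | u 0%R i != 0%R]|)%N.
  rewrite lt0n; apply: contraNneq u0 => /card0_eq z; apply/eqP/rowP => i.
  by have := z i; rewrite !inE mxE => /negbT; rewrite negbK => /eqP.
by case/(eq_bigmax_cond (fun i : 'I_m => i.+1)) => i iu e; exists i.
Qed.

(** A vector of [W] with least leading position gives [u]. Clearing the entry at
    that position in a vector outside the line of [u] gives [v], whose leading
    position is then strictly larger. *)
Lemma in_cycle_reduced (F : finFieldType) m (a : grid m) (W : {vspace 'rV[F]_m}) :
  in_cycle a W -> exists p u v, [/\ (gx p <= gx a)%N && (gy p <= gy a)%N,
    (u, v) \in reduced_pairs F p & W = <<[:: u; v]>>%VS].
Proof.
case/and3P=> /eqP dW; rewrite lt0n dimv_eq0 -vpick0; set w := vpick _ => w0 /subvP Wy.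
have : w \in (W :&: flag F m (gx a))%VS by apply: memv_pick.
rewrite memv_cap => /andP[wW wx].
have Pw : [pred u | (u != 0) && (u \in W)] w by rewrite /= w0.
case: (arg_minnP (@lead F m) Pw) => u0 /andP[u00 u0W] umin.
have [i li ui] := lead_coord u00.
pose u := (u0 0 i)^-1 *: u0.
have uW : u \in W by rewrite memvZ.
have ui1 : u 0 i = 1 by rewrite mxE mulVf.
have uA : u \in flag F m i.+1 by rewrite memvZ // lead_flag li.
have un0 : u != 0 by apply: contraPneq ui1 => ->; rewrite mxE => /eqP; rewrite eq_sym oner_eq0.
have /subvPn[v0 v0W v0u] : ~~ (W <= <[u]>)%VS.
  by apply/negP => /dimvS; rewrite dW dim_vline; case: eqP.
pose v1 := v0 - v0 0 i *: u.
have v1W : v1 \in W by rewrite memvB ?memvZ.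
have v10 : v1 != 0.
  by apply: contraNneq v0u => /eqP; rewrite subr_eq0 => /eqP->; rewrite memvZ ?memv_line.
have v1i : v1 0 i = 0 by rewrite !mxE mulVf // mulr1 subrr.
have [j lj vj] := lead_coord v10.
pose v := (v1 0 j)^-1 *: v1.
have ij : (i < j)%N.
  have : (lead u0 <= lead v1)%N by apply: umin; rewrite /= v10.
  rewrite li lj ltnS leq_eqVlt => /orP[/eqP/val_inj e|//].
  by move: vj; rewrite -e v1i eqxx.
have [|p [ex ey]] := @exists_point m i.+1 j.+1 ij; first exact: ltn_ord.
have eox : ordx p = i by apply: val_inj; rewrite /= ex.
have eoy : ordy p = j by apply: val_inj; rewrite /= ey.
have vW : v \in W by rewrite memvZ.
have uv : (u, v) \in reduced_pairs F p.
  apply/reducedP; rewrite ex ey eox eoy; split=> //.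
  - by rewrite memvZ // lead_flag lj.
  - by rewrite mxE mulVf.
  - by rewrite mxE v1i mulr0.
exists p, u, v; split=> //; last by rewrite (free_pair_span dW) // (reduced_free uv).
rewrite ex ey -li -lj -!lead_flag (Wy _ v1W) andbT lead_flag.
by rewrite (leq_trans (umin w _)) -?lead_flag //= w0.
Qed.

(** The planes with pivots at [p] form the Schubert cell of [p]; it is contained in
    the union exactly when [p] is in the grid. *)
Lemma num_pointsE (F : finFieldType) m (U : {set grid m}) :
  num_points F U = (\sum_(p in grid_of U) #|F| ^ wt p)%N.
Proof.
pose T := [set z : grid m * ('rV[F]_m * 'rV[F]_m) | (z.1 \in grid_of U) && (z.2 \in reduced_pairs F z.1)].
pose plane (z : grid m * ('rV[F]_m * 'rV[F]_m)) := <<[:: z.2.1; z.2.2]>>%VS.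
rewrite /num_points.
have -> : [set W : {vspace 'rV[F]_m} | in_union U W] = [set plane z | z in T].
  apply/setP => W; rewrite inE; apply/existsP/imsetP.
    case=> a /andP[aU /in_cycle_reduced[p [u [v [pa uv ->]]]]].
    exists (p, (u, v)); rewrite // inE /= uv andbT; apply/mem_grid_of; by exists a.
  case=> -[p [u v]]; rewrite inE /= => /andP[/mem_grid_of[a aU /andP[xa ya]] uv] ->.
  exists a; rewrite aU /=; have [uA vA _ _ _] := reducedP _ _ _ uv.
  apply: in_cycle_span xa ya uA vA _ (reduced_free uv).
  by have [] := grid_range p; lia.
rewrite card_in_imset; last first.
  move=> [p [u v]] [q [u' v']]; rewrite inE => /andP[_ h].
  rewrite inE => /andP[_ h'] e.
  by have [-> -> ->] := @reduced_unique F m p q u v u' v' h h' e.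
rewrite -sum1dep_card -(pair_big_dep (mem (grid_of U)) (fun p z => z \in reduced_pairs F p) (fun _ _ => 1%N)) /=.
by apply: eq_bigr => p _; rewrite sum1_card card_reduced_pairs.
Qed.

Local Open Scope nat_scope.

(** * Sets of points on levels *)

Section Levels.
Variables (T : finType) (h : T -> nat).

(** Going down one level at a time inside [X], every point reaches a level at most
    [b]. *)
Definition graded_from (b : nat) (X : {set T}) :=
  forall p, p \in X -> h p <= b \/ exists2 p', p' \in X & h p = (h p').+1.

(** The points met on the way down from [p] all lie in [X]. *)
Lemma graded_height b X p : graded_from b X -> p \in X -> h p < b + #|X|.
Proof.
move=> gX pX; apply: leq_trans (_ : _ < b + #|[set p' in X | h p' <= h p]|) _; last first.
  by rewrite leq_add2l subset_leq_card //; apply/subsetP => z; rewrite !inE => /andP[].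
have [n] := ubnP (h p); elim: n => // n IH in p pX *; rewrite ltnS => hn.
set Y := [set _ in _ | _].
have pY : p \in Y by rewrite !inE pX leqnn.
have [le|[p' p'X e]] := gX p pX.
  have : 0 < #|Y| by rewrite card_gt0; apply/set0Pn; exists p.
  lia.
have := IH p' p'X; rewrite e in hn; move/(_ hn).
set Z := [set _ in _ | _] => hZ.
suff : #|Z| < #|Y| by lia.
apply/proper_card/properP; split; last by exists p; rewrite // !inE e ltnn andbF.
by apply/subsetP => z; rewrite !inE e => /andP[-> /leqW].
Qed.

(** The [k]-th lowest point of [X], counted from 0, has level at most [b + k]. *)
Lemma graded_sum_le q b X : 0 < q -> graded_from b X ->
  \sum_(p in X) q ^ h p <= \sum_(k < #|X|) q ^ (b + k).
Proof.
move=> q0; move: {2}#|X| (erefl #|X|) => n; elim: n X => [|n IH] X cX gX.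
  by rewrite (cards0_eq cX) big_set0.
have /card_gt0P[p0 p0X] : 0 < #|X| by rewrite cX.
case: (arg_maxnP h p0X) => p pX pmax; have {}pX : p \in X := pX.
have gXp : graded_from b (X :\ p).
  move=> z; rewrite !inE => /andP[_ zX]; have [|[z' z'X e]] := gX z zX; first by left.
  right; exists z' => //; rewrite !inE z'X andbT; apply/eqP => zp.
  by have /= := pmax z zX; rewrite e zp; lia.
have cXp : #|X :\ p| = n by have := cardsD1 p X; rewrite pX cX; lia.
rewrite (big_setD1 p) //= addnC cX big_ord_recr /= leq_add //.
  by rewrite -cXp IH.
by rewrite leq_pexp2l // -ltnS -addnS -cX graded_height.
Qed.

Lemma level_segment (S : {set T}) n b :
  {in S &, injective h} -> (forall p, p \in S -> b <= h p < b + n) ->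
  (forall k, k < n -> exists2 p, p \in S & h p = b + k) ->
  #|S| = n /\ forall q, \sum_(p in S) q ^ h p = \sum_(k < n) q ^ (b + k).
Proof.
move=> inj hS onto; have [f fP] : exists f : 'I_n -> T, forall k, f k \in S /\ h (f k) = b + k.
  apply: (@fin_all_exists _ (fun=> T) (fun (k : 'I_n) p => p \in S /\ h p = b + k)) => k.
  by have [p pS e] := onto k (ltn_ord k); exists p.
have finj : injective f.
  move=> i j /(congr1 h); have [_ ->] := fP i.
  by have [_ ->] := fP j => /addnI /val_inj.
have -> : S = [set f k | k : 'I_n].
  apply/setP => p; apply/idP/imsetP => [pS|[k _ ->]]; last by have [] := fP k.
  have hk : h p - b < n by have := hS p pS; lia.
  exists (Ordinal hk) => //; have [fS e] := fP (Ordinal hk); apply: inj => //.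
  by rewrite e /=; have := hS p pS; lia.
split=> [|q]; first by rewrite card_imset ?card_ord.
rewrite big_imset /=; last by move=> i j _ _; apply: finj.
by apply: eq_bigr => k _; have [_ ->] := fP k.
Qed.

(** The points of [D] missing from [U] are traded for points of [U] outside [D] on
    the same levels. This changes no sum and turns [U] into [D] together with a
    graded set of [e] points. *)
Lemma exchange_le q b e (phi : T -> T) (D U : {set T}) :
  0 < q -> #|U| = #|D| + e ->
  {in D :\: U &, injective phi} ->
  (forall p, p \in D :\: U -> phi p \in U :\: D /\ h (phi p) = h p) ->
  graded_from b ((U :\: D) :\: phi @: (D :\: U)) ->
  \sum_(p in U) q ^ h p <= \sum_(p in D) q ^ h p + \sum_(k < e) q ^ (b + k).
Proof.
move=> q0 cU inj phiP gX; set R := phi @: (D :\: U) in gX *.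
have cR : #|R| = #|D :\: U| by apply: card_in_imset.
have RU : R \subset U :\: D.
  by apply/subsetP => _ /imsetP[p pD ->]; have [] := phiP p pD.
have sR : \sum_(p in R) q ^ h p = \sum_(p in D :\: U) q ^ h p.
  by rewrite big_imset //; apply: eq_bigr => p /phiP[_ ->].
have cX : #|(U :\: D) :\: R| = e.
  have := cardsID D U; have := cardsID U D; rewrite setIC.
  have := cardsID R (U :\: D); rewrite (setIidPr RU); lia.
rewrite (big_setID D) /= (big_setID (A := D) U) /= setIC -addnA leq_add2l.
rewrite (big_setID R) /= (setIidPr RU) sR leq_add2l -cX.
exact: graded_sum_le.
Qed.

(** One more point on the top level outweighs all lower points of [U], of
    which there are at most [q]. *)
Lemma top_level_le q d (U C : {set T}) :
  0 < q -> #|U| <= q -> (forall p, p \in U -> h p <= d) ->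
  #|[set p in U | h p == d]| < #|[set p in C | h p == d]| ->
  \sum_(p in U) q ^ h p <= \sum_(p in C) q ^ h p.
Proof.
move=> q0 Uq Ud.
have split_sum (A : {set T}) : \sum_(p in A) q ^ h p =
    #|[set p in A | h p == d]| * q ^ d + \sum_(p in A | h p != d) q ^ h p.
  rewrite (bigID (fun p => h p == d)) /=; congr addn.
  rewrite (eq_bigr (fun=> q ^ d)) => [|p /andP[_ /eqP->]] //.
  by rewrite sum_nat_const; congr (_ * _); apply: eq_card => p; rewrite !inE.
move=> lt; rewrite !split_sum; apply: leq_trans (leq_addr _ _).
apply: leq_trans (leq_mul lt (leqnn _)); rewrite mulSn addnC leq_add2r.
case: d Ud {lt split_sum} => [|d] Ud.
  by rewrite big1 // => p /andP[/Ud]; rewrite leqn0 => ->.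
rewrite expnS; apply: leq_trans (leq_mul Uq (leqnn _)).
rewrite -sum_nat_const; rewrite [leqRHS](bigID (fun p => h p != d.+1)) /=.
apply: leq_trans (leq_addr _ _); apply: leq_sum => p /andP[pU ne].
by rewrite leq_pexp2l //; have := Ud p pU; lia.
Qed.

End Levels.

(** * Down-closed sets of grid points *)

Definition points (q m : nat) (D : {set grid m}) := \sum_(p in D) q ^ wt p.

Definition down_closed m (D : {set grid m}) :=
  forall p q, p \in D -> gx q <= gx p -> gy q <= gy p -> q \in D.

Lemma grid_of_down_closed m (U : {set grid m}) : down_closed (grid_of U).
Proof.
move=> p q /mem_grid_of[a aU /andP[xa ya]] xq yq; apply/mem_grid_of.
by exists a; rewrite // (leq_trans xq) ?(leq_trans yq).
Qed.

Lemma grid_of_id m (D : {set grid m}) : down_closed D -> grid_of D = D.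
Proof.
move=> dD; apply/setP => p; apply/mem_grid_of/idP => [[a aD /andP[xa ya]]|pD].
  exact: dD aD xa ya.
by exists p; rewrite ?leqnn.
Qed.

Definition rect m x y : {set grid m} := [set p | (gx p <= x) && (gy p <= y)].
Definition row_seg m b c : {set grid m} := [set p | (gy p == b) && (gx p <= c)].
Definition col_seg m a c : {set grid m} := [set p | (gx p == a) && (gy p <= a + c)].

Lemma row_segE m b c : c < b <= m ->
  #|row_seg m b c| = c /\ forall q, points q (row_seg m b c) = \sum_(k < c) q ^ (b - 2 + k).
Proof.
move=> cb; apply: (@level_segment _ (@wt m)) => [p p'|p|k kc].
- rewrite !inE => /andP[/eqP y _] /andP[/eqP y' _]; rewrite /wt => e.
  have [] := grid_range p; have [] := grid_range p'; move=> *; apply: grid_eq; lia.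
- by rewrite inE /wt => /andP[/eqP y xc]; have [] := grid_range p; lia.
have [||p [x y]] := @exists_point m k.+1 b; [lia|lia|].
by exists p; rewrite ?inE /wt ?x ?y; lia.
Qed.

Lemma col_segE m a c : 0 < a -> a + c <= m ->
  #|col_seg m a c| = c /\ forall q, points q (col_seg m a c) = \sum_(k < c) q ^ (a.*2 - 2 + k).
Proof.
move=> a0 ac; apply: (@level_segment _ (@wt m)) => [p p'|p|k kc].
- rewrite !inE => /andP[/eqP x _] /andP[/eqP x' _]; rewrite /wt => e.
  have [] := grid_range p; have [] := grid_range p'; move=> *; apply: grid_eq; lia.
- by rewrite inE /wt => /andP[/eqP x yc]; have [] := grid_range p; lia.
have [||p [x y]] := @exists_point m a (a + k).+1; [lia|lia|].
by exists p; rewrite ?inE /wt ?x ?y; lia.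
Qed.

(** Column [i] of the rectangle has [y - i] points, so the count is
    [x * y - x * (x + 1) / 2]. On an antidiagonal [x + y = s] this is a concave
    function of [x]. *)
Lemma card_rect m x y : x <= y <= m ->
  #|rect m x y| * 2 + x * x.+1 = x * y * 2.
Proof.
elim: x => [|x IH] xy.
  have -> : rect m 0 y = set0; last by rewrite cards0.
  by apply/setP => p; rewrite !inE; have [] := grid_range p; lia.
have -> : rect m x.+1 y = rect m x y :|: col_seg m x.+1 (y - x.+1).
  by apply/setP => p; rewrite !inE; have [] := grid_range p; lia.
rewrite cardsU disjoint_setI0.
  rewrite cards0 subn0; have [|-> _] := @col_segE m x.+1 (y - x.+1) isT; first by lia.
  by have := IH ltac:(lia); nia.
by rewrite disjoints_subset; apply/subsetP => p; rewrite !inE; lia.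
Qed.

Lemma rect_sub m (D : {set grid m}) p : down_closed D -> p \in D ->
  rect m (gx p) (gy p) \subset D.
Proof.
by move=> dD pD; apply/subsetP => q; rewrite inE => /andP[xq yq]; apply: dD pD xq yq.
Qed.

(** A down-closed set is at least as large as the rectangle below any of its
    points; all bounds on the levels that it can reach come from this. *)
Lemma area_le m (D : {set grid m}) p : down_closed D -> p \in D ->
  gx p * gy p * 2 <= #|D| * 2 + gx p * (gx p).+1.
Proof.
move=> dD pD; have [xy ym] := grid_range p.
rewrite -(@card_rect m) ?leq_add2r ?leq_mul2r ?(subset_leq_card (rect_sub dD pD)) //; lia.
Qed.

Definition row_filled m a e : {set grid m} := rect m a a.+1 :|: row_seg m a.+2 e.
Definition col_filled m r e : {set grid m} := rect m r m :|: col_seg m r.+1 e.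

Lemma points_disjointU q m (A B : {set grid m}) :
  [disjoint A & B] -> points q (A :|: B) = points q A + points q B.
Proof. by move=> dAB; rewrite /points -bigU //; apply: eq_bigl => p; rewrite !inE. Qed.

Lemma row_filledE m a e : e <= a -> a < m -> (0 < e -> a.+1 < m) ->
  #|row_filled m a e| = #|rect m a a.+1| + e /\
  forall q, points q (row_filled m a e) = points q (rect m a a.+1) + \sum_(k < e) q ^ (a + k).
Proof.
move=> ea am em; have dis : [disjoint rect m a a.+1 & row_seg m a.+2 e].
  by rewrite disjoints_subset; apply/subsetP => p; rewrite !inE; lia.
case: e => [|e] in ea em dis *.
  have -> : row_filled m a 0 = rect m a a.+1.
    by apply/setP => p; rewrite !inE; have [] := grid_range p; lia.
  by split=> [|q]; rewrite ?big_ord0 addn0.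
have [|c s] := @row_segE m a.+2 e.+1; first by lia.
split=> [|q]; first by rewrite cardsU disjoint_setI0 // cards0 subn0 c.
by rewrite points_disjointU // s !subSS subn0.
Qed.

Lemma col_filledE m r e : r + e < m ->
  #|col_filled m r e| = #|rect m r m| + e /\
  forall q, points q (col_filled m r e) = points q (rect m r m) + \sum_(k < e) q ^ (r.*2 + k).
Proof.
move=> rem; have dis : [disjoint rect m r m & col_seg m r.+1 e].
  by rewrite disjoints_subset; apply/subsetP => p; rewrite !inE; lia.
have [|c s] := @col_segE m r.+1 e isT; first by lia.
split=> [|q]; first by rewrite cardsU disjoint_setI0 // cards0 subn0 c.
by rewrite points_disjointU // s doubleS !subSS subn0.
Qed.

(** * Grids with extremal column sizes *)

(** Only zeros may follow [u] if [u = 0]: otherwise a later entry of [s] would be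
    compared with [v] once the zeros are deleted. *)
Lemma lexi_filter_lt (w s t : seq nat) (u v : nat) :
  all (fun n => 0 < n) w -> (u = 0 -> all (fun n => n == 0) s) -> u < v ->
  (([seq n <- w ++ u :: s | (0 < n)%N] : seqlexi nat) < [seq n <- w ++ v :: t | (0 < n)%N])%O.
Proof.
move=> wp us uv; elim: w wp => [_|x w IH] /=.
  have -> : 0 < v by lia.
  case: u us uv => [s0|u _] uv /=.
    have -> : [seq n <- s | 0 < n] = [::]; last by [].
    by elim: s {s0}(s0 erefl) => //= y s IHs /andP[/eqP-> /IHs].
  by rewrite ltxi_cons !leEnat; apply/andP; split; [lia|apply/implyP; lia].
by case/andP=> x0 /IH; rewrite x0 eqhead_ltxiE.
Qed.

Definition column m (D : {set grid m}) i := [set p in D | gx p == i].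

(** Columns of down-closed sets are initial segments, hence nested. *)
Lemma column_subset m (A B : {set grid m}) i : down_closed A -> down_closed B ->
  #|column A i| <= #|column B i| -> column A i \subset column B i.
Proof.
move=> dA dB; apply: contraTT => /subsetPn[p]; rewrite !inE => /andP[pA /eqP xp].
rewrite xp eqxx andbT -ltnNge => pB; apply/proper_card/properP; split.
  apply/subsetP => q; rewrite !inE => /andP[qB /eqP xq]; rewrite xq eqxx andbT.
  apply: dA pA _ _; first by rewrite xq xp.
  rewrite leqNgt; apply: contra pB => /ltnW yq; apply: dB qB _ yq.
  by rewrite xq xp.
by exists p; rewrite !inE ?pA ?xp ?eqxx // (negPf pB).
Qed.

Lemma column_eq0 m (D : {set grid m}) i j : down_closed D -> 0 < i <= j ->
  #|column D i| = 0 -> #|column D j| = 0.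
Proof.
move=> dD ij /cards0_eq ci; apply/eqP; rewrite cards_eq0 -subset0; apply/subsetP => p.
rewrite inE => /andP[pD /eqP xp]; have [xy ym] := grid_range p.
have [||q [xq yq]] := @exists_point m i (gy p); [lia|lia|].
have : q \in column D i by rewrite inE xq eqxx andbT; apply: dD pD _ _; lia.
by rewrite ci inE.
Qed.

Lemma M_seq_lt m (U V : {set grid m}) i : 0 < i <= m ->
  (forall j, 0 < j < i -> column_size U j = column_size V j) ->
  column_size U i < column_size V i -> (M_seq U < M_seq V)%O.
Proof.
move=> im before lt; rewrite /M_seq.
have -> : iota 1 m = iota 1 i.-1 ++ i :: iota i.+1 (m - i).
  have -> : m = i.-1 + (m - i).+1 by lia.
  rewrite iotaD /=; congr (_ ++ _ :: _); first by lia.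
  congr iota; lia.
rewrite !map_cat !map_cons.
have -> : [seq column_size U j | j <- iota 1 i.-1] = [seq column_size V j | j <- iota 1 i.-1].
  by apply/eq_in_map => j; rewrite mem_iota => hj; apply: before; lia.
have dU := @grid_of_down_closed m U; have dV := @grid_of_down_closed m V.
apply: (lexi_filter_lt _ _ _ lt) => [|Ui].
  apply/allP => _ /mapP[j + ->]; rewrite mem_iota => hj; rewrite lt0n.
  apply: contraTneq lt => /(column_eq0 dV (j := i)) Vi.
  have -> : column_size V i = 0 by apply: Vi; lia.
  by [].
apply/allP => _ /mapP[j + ->]; rewrite mem_iota => hj.
by apply/eqP/(column_eq0 dU _ Ui); lia.
Qed.

Lemma first_difference m (A B : {set grid m}) : A != B ->
  exists i, [/\ 0 < i <= m, forall j, j < i -> column A j = column B j & column A i != column B i].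
Proof.
move=> AB; have ex : exists i, column A i != column B i.
  have [p pAB] : exists p, (p \in A) != (p \in B).
    apply/existsP; apply: contraNT AB => /existsPn H; apply/eqP/setP => p.
    by have := H p; rewrite negbK => /eqP.
  exists (gx p); apply: contra pAB => /eqP/setP/(_ p); by rewrite !inE eqxx !andbT => ->.
case: (ex_minnP ex) => i ci imin; exists i; split=> //; last first.
  by move=> j ji; apply/eqP; apply: contraTT ji => /imin; rewrite -leqNgt.
have [p _ /eqP <-] : exists2 p, p \in [set: grid m] & gx p == i.
  have [p] : exists p, (p \in column A i) != (p \in column B i).
    apply/existsP; apply: contraNT ci => /existsPn H; apply/eqP/setP => p.
    by have := H p; rewrite negbK => /eqP.
  by rewrite !inE; case: (altP (gx p =P i)) => [<-|]; [exists p|rewrite !andbF].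
by have [] := grid_range p; lia.
Qed.

Definition row_initial m (C : {set grid m}) :=
  forall c p, c \in C -> gy p < gy c -> p \in C.

Definition col_initial m (C : {set grid m}) :=
  forall c p, c \in C -> gx p < gx c -> p \in C.

(** In the first column where they differ, [V] cannot be the lower one: a point [c]
    of [C] would lie above that column of [V], and so above all later columns,
    whose points then lie in earlier rows than [c]; so [V] would be contained in
    [C]. *)
Lemma row_initial_first m (C V : {set grid m}) : down_closed C -> down_closed V ->
  row_initial C -> #|V| = #|C| -> V != C ->
  exists i, [/\ 0 < i <= m, forall j, j < i -> #|column C j| = #|column V j| & #|column C i| < #|column V i|].
Proof.
move=> dC dV rC cVC nVC; have [i [im before ci]] := first_difference nVC.
exists i; split=> // [j ji|]; first by rewrite before.
have : ~~ (V \subset C).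
  by apply: contra nVC => sVC; rewrite eqEcard sVC cVC leqnn.
rewrite ltnNge; apply: contra => le.
have sub := column_subset dV dC le.
have /subsetPn[c cC cV] : ~~ (column C i \subset column V i).
  by apply: contra ci => sub'; rewrite eqEsubset sub.
move: cC cV; rewrite !inE => /andP[cC /eqP xc]; rewrite xc eqxx andbT => cV.
apply/subsetP => p pV; case: (ltnP (gx p) i) => pi.
  by have := before _ pi => /setP/(_ p); rewrite !inE pV eqxx !andbT => <-.
apply: (rC c) => //; rewrite ltnNge; apply: contra cV => yc; apply: dV pV _ yc.
by rewrite xc.
Qed.

(** In the first column where they differ, [V] cannot be the higher one: a point of
    [V] outside [C] in that column forces all later columns of [C] to be empty, so
    [C] would be contained in [V]. *)
Lemma col_initial_first m (C V : {set grid m}) : down_closed C -> down_closed V ->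
  col_initial C -> #|V| = #|C| -> V != C ->
  exists i, [/\ 0 < i <= m, forall j, j < i -> #|column V j| = #|column C j| & #|column V i| < #|column C i|].
Proof.
move=> dC dV rC cVC nVC; have [i [im before ci]] := first_difference nVC.
exists i; split=> // [j ji|]; first by rewrite before.
have : ~~ (C \subset V).
  by apply: contra nVC => sVC; rewrite eq_sym eqEcard sVC cVC leqnn.
rewrite ltnNge; apply: contra => le.
have sub := column_subset dC dV le.
have /subsetPn[v vV vC] : ~~ (column V i \subset column C i).
  by apply: contra ci => sub'; rewrite eqEsubset sub andbT.
move: vV vC; rewrite !inE => /andP[vV /eqP xv]; rewrite xv eqxx andbT => vC.
apply/subsetP => p pC; case: (ltngtP (gx p) i) => pi.
- by have := before _ pi => /setP/(_ p); rewrite !inE pC eqxx !andbT /= => ->.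
- by case/negP: vC; apply: (rC p) => //; rewrite xv.
by have := subsetP sub p; rewrite !inE pC pi eqxx !andbT; apply.
Qed.

Lemma M_seq_grid m (U V : {set grid m}) : grid_of U = grid_of V -> M_seq U = M_seq V.
Proof. by move=> e; rewrite /M_seq /column_size e. Qed.

Lemma minimal_M_row_initial k m K (C : {set grid m}) : down_closed C -> row_initial C -> #|C| = K ->
  has_minimal_M k K C /\ forall U, has_minimal_M k K U -> grid_of U = C.
Proof.
move=> dC rC cC; have gC := grid_of_id dC.
have lt V : spanning_dim k V = K -> grid_of V != C -> (M_seq C < M_seq V)%O.
  rewrite spanning_dimE -cC => cV nV.
  have [i [im before lt]] := row_initial_first dC (@grid_of_down_closed m V) rC cV nV.
  apply: (M_seq_lt im); rewrite /column_size gC // => j /andP[_]; exact: before.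
split.
  split; first by rewrite spanning_dimE gC.
  move=> V /lt ltV; have [e|/ltV/ltW//] := eqVneq (grid_of V) C.
  by rewrite (@M_seq_grid _ C V) // gC.
move=> U [cU minU]; apply/eqP/negP => /negP /(lt U cU).
by rewrite ltNge minU // spanning_dimE gC.
Qed.

Lemma maximal_M_col_initial k m K (C : {set grid m}) : down_closed C -> col_initial C -> #|C| = K ->
  has_maximal_M k K C /\ forall U, has_maximal_M k K U -> grid_of U = C.
Proof.
move=> dC rC cC; have gC := grid_of_id dC.
have lt V : spanning_dim k V = K -> grid_of V != C -> (M_seq V < M_seq C)%O.
  rewrite spanning_dimE -cC => cV nV.
  have [i [im before lt]] := col_initial_first dC (@grid_of_down_closed m V) rC cV nV.
  apply: (M_seq_lt im); rewrite /column_size gC // => j /andP[_]; exact: before.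
split.
  split; first by rewrite spanning_dimE gC.
  move=> V /lt ltV; have [e|/ltV/ltW//] := eqVneq (grid_of V) C.
  by rewrite (@M_seq_grid _ C V) // gC.
move=> U [cU minU]; apply/eqP/negP => /negP /(lt U cU).
by rewrite ltNge minU // spanning_dimE gC.
Qed.

Lemma row_filled_down_closed m a e : e <= a.+1 -> down_closed (row_filled m a e).
Proof. move=> ea p q; rewrite !inE; have [] := grid_range q; lia. Qed.

Lemma row_filled_initial m a e : row_initial (row_filled m a e).
Proof. move=> c p; rewrite !inE; have [] := grid_range p; lia. Qed.

Lemma col_filled_down_closed m r e : r + e < m -> down_closed (col_filled m r e).
Proof. move=> rem p q; rewrite !inE; have [] := grid_range q; lia. Qed.

Lemma col_filled_initial m r e : col_initial (col_filled m r e).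
Proof. move=> c p; rewrite !inE; have [] := grid_range p; lia. Qed.

Lemma row_decomposition m K : 0 < m -> K <= 'C(m, 2) ->
  exists a e, [/\ K * 2 = a * a.+1 + e * 2, e <= a, a < m & 0 < e -> a.+1 < m].
Proof.
move=> m0 Km; have {}Km : K * 2 <= m * m.-1.
  by rewrite bin2 in Km; have := odd_double_half (m * m.-1); lia.
have [a aK amax] : exists2 a, a * a.+1 <= K * 2 & K * 2 < a.+1 * a.+2.
  elim: K {Km} => [|K [a aK amax]]; first by exists 0.
  by have [lt|ge] := ltnP (K.+1 * 2) (a.+1 * a.+2); [exists a|exists a.+1]; nia.
have ev : ~~ odd (a * a.+1) by rewrite oddM /= andbN.
exists a, (K - (a * a.+1)./2); have := odd_double_half (a * a.+1).
rewrite (negPf ev) => half; split; try nia.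
Qed.

Lemma col_decomposition m K : 0 < m -> K <= 'C(m, 2) ->
  exists r e, [/\ r < m, r + e < m, K * 2 + r * r.+1 = r * m * 2 + e * 2 &
    r.+1 < m -> r.+1 + e < m].
Proof.
move=> m0 Km; have {}Km : K * 2 <= m * m.-1.
  by rewrite bin2 in Km; have := odd_double_half (m * m.-1); lia.
elim: K Km => [_|K IH Km]; first by exists 0, 0; split; lia.
have [r [e [rm rem eK rem']]] := IH ltac:(lia).
have [h|h] := ltnP (r.+2 + e) m; first by exists r, e.+1; split; lia.
by exists r.+1, 0; split; nia.
Qed.

(** * Points on the top antidiagonal *)

(** Beyond [x + y = 6 m / 5] the end of the antidiagonal near [y = x + 1] carries
    the smallest rectangle, and [a.*2.+1 + (e == a)] is the highest antidiagonal
    on which that rectangle fits into [a * (a + 1) / 2 + e] points. *)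
Lemma row_top_bound m a e x y : e <= a -> x < y <= m ->
  x * y * 2 <= a * a.+1 + e * 2 + x * x.+1 -> 6 * m + 11 <= 5 * (x + y) ->
  x + y <= a.*2.+1 + (e == a).
Proof.
move=> ea xym area far; have [d ey] : exists d, y = x.+1 + d by exists (y - x.+1); lia.
have far' : d + 12 <= 4 * x by lia.
subst y; rewrite leqNgt; apply/negP => gt.
have slack : d * (d + 12) <= d * (4 * x) by rewrite leq_mul.
have [ea'|ne] := eqVneq e a.
  have h : a.*2 + 2 <= x.*2 + d by lia.
  have h2 : (a.*2 + 2) * (a.*2 + 2) <= (x.*2 + d) * (x.*2 + d) by rewrite leq_mul.
  subst e; clear - area h h2 slack; lia.
have ea' : e < a by lia.
have [d0|d0] := posnP d.
  have h : a.+1 <= x by lia.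
  have h2 : a.+1 * a.+2 <= x * x.+1 by rewrite leq_mul.
  subst d; clear - area h h2 ea'; lia.
have h : a.*2 + 1 <= x.*2 + d by lia.
have h2 : (a.*2 + 1) * (a.*2 + 1) <= (x.*2 + d) * (x.*2 + d) by rewrite leq_mul.
have [d' ed] : exists d', d = d'.+1 by exists d.-1; lia.
have slack' : d' * (d + 12) <= d' * (4 * x) by rewrite leq_mul.
subst d; clear - area h h2 slack' ea'; lia.
Qed.

(** With [x = a - j], the rectangle below a point of the top antidiagonal exceeds
    the triangle of size [a] by [j * (2 a - 1 - 3 j) / 2] (if [e < a]), which is at
    most [a - 1] only for [j = 1] and in one further case. *)
Lemma row_top_points m a e x y : e <= a -> x < y <= m -> x < a ->
  x * y * 2 <= a * a.+1 + e * 2 + x * x.+1 ->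
  6 * m + 11 <= 5 * (a.*2.+1 + (e == a)) -> a.*2.+1 + (e == a) <= x + y ->
  [/\ x.+1 = a, y = a.+2 & e < a] \/ [/\ a = 6, e = 5, m = 9, x = 4 & y = 9].
Proof.
move=> ea xym xa area far top.
have [j [ej j0]] : exists j, a = x + j /\ 0 < j by exists (a - x); lia.
have [d ed] : exists d, y = a.+1 + (e == a) + j + d by exists (y - (a.+1 + (e == a) + j)); lia.
have [ea'|ne] := eqVneq e a.
  rewrite ea' eqxx /= in far ed.
  have h : j + 7 <= 2 * x by lia.
  have h2 : j * (j + 7) <= j * (2 * x) by rewrite leq_mul.
  rewrite ea' ed ej in area; clear - area h h2 j0; lia.
rewrite (negPf ne) !addn0 in far top ed; have ea' : e < a by lia.
have [u eu] : exists u, 2 * x = j + 3 * d + 6 + u.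
  by exists (2 * x - (j + 3 * d + 6)); lia.
have h2 : 2 * x * j = (j + 3 * d + 6 + u) * j by rewrite eu.
have key : 2 * x * j + 2 * x * d + 2 <= j * j + 3 * j + 2 * x.
  by rewrite ed ej in area; clear - area ea' ej; lia.
have d0 : d = 0.
  case: d {ed} eu h2 key => // d eu h2 key; clear - eu h2 key j0.
  have h3 : 0 < x by lia.
  have : u <= u * j by rewrite leq_pmulr.
  lia.
subst d; have [j1|j1] := leqP j 1; first by left; split; lia.
right; have h3 : u * 2 <= u * j by rewrite leq_mul.
split; lia.
Qed.

(** With [x = r + j], the rectangle below a point of the top antidiagonal exceeds
    the first [r] columns by [j * (2 m - 4 r - 1 - 3 j) / 2]; for [j >= 2] this is
    more than a partial column has. *)
Lemma col_top_points m r e x y : r.*2.*2 + r + 10 <= m -> r.+1 + e < m -> x < y <= m -> r < x ->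
  x * y * 2 + r * r.+1 <= r * m * 2 + e * 2 + x * x.+1 -> m + r <= x + y -> x = r.+1.
Proof.
move=> far em xym rx area top; apply/eqP; rewrite eqn_leq rx andbT leqNgt; apply/negP => rx'.
have [h|h] := leqP (m + r) (x.*2.+1).
  have h1 : x * x.+1 <= x * y by rewrite leq_mul //; lia.
  have h2 : (m + r) * (m + r) <= x.*2.+1 * x.*2.+1 by apply: leq_mul.
  have [w ew] : exists w, m = 5 * r + 10 + w by exists (m - 5 * r - 10); lia.
  subst m; clear - area h1 h2 em; lia.
have [v ev] : exists v, m + r = x.*2.+2 + v by exists (m + r - x.*2.+2); lia.
have h1 : x * (x.+2 + v) <= x * y by rewrite leq_mul //; lia.
have [j [ej j2]] : exists j, x = r + j /\ 2 <= j by exists (x - r); lia.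
have em' : m = r + j.*2 + 2 + v by lia.
have h2 : j * (4 * r + 8) <= j * (2 * j + v) by rewrite leq_mul //; lia.
have h3 : 2 * v <= j * v by rewrite leq_mul.
subst m x; clear - h1 h2 h3 area em j2; lia.
Qed.

(** * Comparison with the extremal grids *)

(** Outside the triangle a step to the left stays outside, and in the first column
    a step down does until row [a + 2] is reached. The only point of [R] could be
    met in a step to the left from [(a, a + 2)]. *)
Lemma row_graded m a (D R : {set grid m}) : down_closed D -> 2 < a ->
  (forall p, p \in R -> [/\ gx p = a.-1, gy p = a.+2 &
     forall p', p' \in D -> ~ (gx p' = a /\ gy p' = a.+2)]) ->
  graded_from (@wt m) a ((D :\: rect m a a.+1) :\: R).
Proof.
move=> dD a2 RP p; rewrite !inE => /and3P[pR prect pD]; rewrite /wt.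
have [xy ym] := grid_range p.
have step x y : 0 < x < y -> y <= m -> a.+2 <= y -> x <= gx p -> y <= gy p -> x + y + 1 = gx p + gy p ->
   ~~ ((x == a.-1) && (y == a.+2) && (R != set0)) ->
   exists2 p', p' \in ((D :\: rect m a a.+1) :\: R) & gx p + gy p - 3 = (gx p' + gy p' - 3).+1.
  move=> xy' ym' ay xx yy sm nR; have [p' [ex ey]] := exists_point xy' ym'.
  exists p'; last by rewrite ex ey; lia.
  rewrite !inE ex ey; apply/and3P; split; [|lia|by apply: dD pD _ _; rewrite ?ex ?ey].
  apply: contra nR => p'R; have [<- <- _] := RP p' p'R.
  by rewrite ex ey !eqxx; apply/set0Pn; exists p'.
have [x1|x1] := leqP (gx p) 1.
  have [y2|y2] := leqP (gy p) a.+2; first by left; lia.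
  by right; apply: (step (gx p) (gy p).-1); lia.
right; apply: (step (gx p).-1 (gy p)); try lia.
apply/negP => /andP[/andP[/eqP ex /eqP ey] /set0Pn[r /RP[_ _ /(_ p pD)]]].
by apply; lia.
Qed.

(** By [row_top_points], a set that reaches the top level contains the triangle up
    to a swap of two points on the same level; then [exchange_le] applies. The
    sets that do not reach the top level, and one set for [m = 9] with too few
    points there, lose by [top_level_le]. *)
Lemma row_filled_max m a e (D : {set grid m}) q :
  e <= a -> a < m -> (0 < e -> a.+1 < m) ->
  6 * m + 11 <= 5 * (a.*2.+1 + (e == a)) ->
  down_closed D -> #|D| = #|rect m a a.+1| + e -> #|D| <= q -> 0 < q ->
  points q D <= points q (row_filled m a e).
Proof.
move=> ea am em far dD cD Dq q0.
have a2 : 2 < a by lia.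
have cR := @card_rect m a a.+1 ltac:(lia).
have area p : p \in D -> gx p * gy p * 2 <= a * a.+1 + e * 2 + gx p * (gx p).+1.
  by move=> /(area_le dD); lia.
have [p0 [x0 y0]] := @exists_point m a a.+1 ltac:(lia) am.
have rect_of_p0 : p0 \in D -> rect m a a.+1 \subset D.
  by move=> /(rect_sub dD); rewrite x0 y0.
have [cC sC] := row_filledE ea am em.
have [p0D|p0D] := boolP (p0 \in D).
  have D0 : rect m a a.+1 :\: D = set0 by apply/eqP; rewrite setD_eq0 rect_of_p0.
  rewrite sC; apply: (exchange_le (phi := id) q0 cD).
  - by move=> p p'; rewrite D0 inE.
  - by move=> p; rewrite D0 inE.
  by rewrite D0 imset0; apply: row_graded => // p; rewrite inE.
have xlt p : p \in D -> gx p < a.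
  move=> pD; rewrite ltnNge; apply: contra p0D => ap; apply: dD pD _ _.
    by rewrite x0.
  by rewrite y0; have [] := grid_range p; lia.
have [top [topC wtop]] : exists top, top \in row_filled m a e /\ wt top = a.*2.+1 + (e == a) - 3.
  have [e1|e1] := eqVneq e a; last first.
    by exists p0; rewrite !inE x0 y0 /wt x0 y0 !leqnn; split; lia.
  have [t [xt yt]] := @exists_point m a a.+2 ltac:(lia) ltac:(lia).
  by exists t; rewrite !inE /wt xt yt e1; lia.
have [/existsP[p /andP[pD ptop]]|none] := boolP [exists p in D, a.*2.+1 + (e == a) <= gx p + gy p]; last first.
  apply: (@top_level_le _ (@wt m) q (a.*2.+1 + (e == a) - 3)) => //.
    move=> p pD; have := existsPn none p; rewrite pD /= -ltnNge /wt; lia.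
  have -> : [set p in D | wt p == a.*2.+1 + (e == a) - 3] = set0.
    apply/setP => p; rewrite !inE; apply/negP => /andP[pD /eqP]; rewrite /wt.
    have := existsPn none p; rewrite pD /= -ltnNge; have [] := grid_range p; lia.
  by rewrite cards0; apply/card_gt0P; exists top; rewrite inE topC wtop eqxx.
have [xy ym] := grid_range p.
have xym : gx p < gy p <= m by lia.
have [[xp yp e1]|[a6 e5 m9 xp yp]] := row_top_points ea xym (xlt p pD) (area p pD) far ptop.
  (* D reaches the top level only at (a-1, a+2): the corner (a, a+1) is all it
     misses of the triangle, and the two points are on the same level. *)
  rewrite sC; have Dp0 : rect m a a.+1 :\: D = [set p0].
    apply/setP => z; rewrite !inE; have [xz yz] := grid_range z; apply/andP/eqP => [[zD /andP[zx zy]]|->].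
      apply: grid_eq; rewrite ?x0 ?y0; have [h|h] := leqP (gx z) a.-1; try lia.
        by case/negP: zD; apply: dD pD _ _; lia.
      by case/negP: zD; apply: dD pD _ _; lia.
    by rewrite x0 y0 !leqnn.
  apply: (exchange_le (phi := fun=> p) q0 cD).
  - by rewrite Dp0 => z z'; rewrite !inE => /eqP-> /eqP->.
  - move=> z; rewrite Dp0 !inE => /eqP->; rewrite pD /wt x0 y0; split; lia.
  apply: row_graded => // _ /imsetP[_ _ ->]; split=> [||z /xlt zx [ze _]].
  - by rewrite -xp.
  - by [].
  by rewrite ze ltnn in zx.
(* In the remaining case m = 9, K = 26, D has one point on the top level and the
   row-filled set has two, (6,7) and (5,8). *)
have DE : D = rect m 4 9.
  apply/eqP; rewrite eq_sym eqEcard; have := rect_sub dD pD; rewrite xp yp => -> /=.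
  have := @card_rect m 4 9 ltac:(lia); move: cR cD; rewrite a6 e5; clear.
  by move: #|D| #|rect m 6 7| #|rect m 4 9|; lia.
apply: (@top_level_le _ (@wt m) q 10) => //.
  by move=> z; rewrite DE inE /wt; lia.
have -> : [set z in D | wt z == 10] = [set p].
  apply/setP => z; rewrite DE !inE /wt; have [] := grid_range z; move=> xz yz.
  apply/andP/eqP => [[zr zt]|->]; last by lia.
  by apply: grid_eq; lia.
have [p1 [x1 y1]] := @exists_point m 5 8 ltac:(lia) ltac:(lia).
have p01 : p0 != p1 by apply/eqP => e01; move: x0; rewrite e01 x1 a6.
rewrite cards1; apply: leq_trans (_ : #|[set p0; p1]| <= _); first by rewrite cards2 p01.
apply: subset_leq_card; apply/subsetP => z; rewrite !inE /wt.
by case/orP => /eqP->; rewrite ?x0 ?y0 ?x1 ?y1 a6 e5.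
Qed.

(** By [col_top_points], a set that reaches the top level either contains the first
    [r] columns, or contains [(r + 1, m - 1)] and misses only an end of row [m];
    both cases are settled by [exchange_le]. *)
Lemma col_filled_max m r e (D : {set grid m}) q :
  r.+1 + e < m -> (0 < r -> r.*2.*2 + r + 10 <= m) ->
  down_closed D -> #|D| = #|rect m r m| + e -> #|D| <= q -> 0 < q ->
  points q D <= points q (col_filled m r e).
Proof.
move=> em far dD cD Dq q0.
have cR := @card_rect m r m ltac:(lia).
have [cC sC] := @col_filledE m r e ltac:(lia).
(* Steps go down within a column where possible; a removed set R that is an upper
   part of column r + 1 is then never entered. *)
have graded (R : {set grid m}) : (forall p, p \in R -> gx p = r.+1 /\ r + 3 < gy p) ->
   (forall p p', p \in R -> p' \in D -> gx p' = r.+1 -> gy p <= gy p' -> p' \in R) ->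
   graded_from (@wt m) r.*2 ((D :\: rect m r m) :\: R).
  move=> Rx Rup p; rewrite !inE /wt => /and3P[pR prect pD].
  have [xy ym] := grid_range p.
  have xr : r < gx p by rewrite ym andbT -ltnNge in prect.
  have step x y : r < x < y -> x <= gx p -> y <= gy p -> x + y + 1 = gx p + gy p ->
     (x = r.+1 -> gx p = r.+1 \/ y <= r + 3) ->
     exists2 p', p' \in ((D :\: rect m r m) :\: R) & gx p + gy p - 3 = (gx p' + gy p' - 3).+1.
    move=> xy' xx yy sm xr1; have [p' [ex ey]] := @exists_point m x y ltac:(lia) ltac:(lia).
    exists p'; last by rewrite ex ey; lia.
    rewrite !inE ex ey; apply/and3P; split; [|lia|by apply: dD pD _ _; rewrite ?ex ?ey].
    apply/negP => p'R; have [ex' ry] := Rx p' p'R; have [px|ly] := xr1 (etrans (esym ex) ex').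
      by case/negP: pR; apply: Rup p'R pD px _; rewrite ey.
    by rewrite ey in ry; lia.
  have [y2|y2] := ltnP (gx p).+1 (gy p).
    by right; apply: (step (gx p) (gy p).-1); lia.
  have [x1|x1] := leqP (gx p) r.+1; first by left; lia.
  by right; apply: (step (gx p).-1 (gy p)); lia.
have [sub|nsub] := boolP (rect m r m \subset D).
  have D0 : rect m r m :\: D = set0 by apply/eqP; rewrite setD_eq0.
  rewrite sC; apply: (exchange_le (phi := id) q0 cD).
  - by move=> p p'; rewrite D0 inE.
  - by move=> p; rewrite D0 inE.
  by rewrite D0 imset0; apply: graded => [p|p p']; rewrite inE.
have r0 : 0 < r.
  rewrite lt0n; apply: contra nsub => /eqP->; apply/subsetP => p; rewrite inE.
  by have [] := grid_range p; lia.
have {}far := far r0.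
have [p0 [x0 y0]] := @exists_point m r m ltac:(lia) ltac:(lia).
have p0D : p0 \notin D.
  by apply: contra nsub => /(rect_sub dD); rewrite x0 y0.
have area p : p \in D -> gx p * gy p * 2 + r * r.+1 <= r * m * 2 + e * 2 + gx p * (gx p).+1.
  by move=> /(area_le dD); lia.
have [/existsP[p /andP[pD ptop]]|none] := boolP [exists p in D, m + r <= gx p + gy p]; last first.
  apply: (@top_level_le _ (@wt m) q (m + r - 3)) => //.
    move=> p pD; have := existsPn none p; rewrite pD /= -ltnNge /wt; lia.
  have -> : [set p in D | wt p == m + r - 3] = set0.
    apply/setP => p; rewrite !inE; apply/negP => /andP[pD /eqP]; rewrite /wt.
    have := existsPn none p; rewrite pD /= -ltnNge; have [] := grid_range p; lia.
  rewrite cards0; apply/card_gt0P; exists p0; rewrite !inE /wt x0 y0; lia.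
have [xy ym] := grid_range p.
have xym : gx p < gy p <= m by lia.
have ylt z : z \in D -> r <= gx z -> gy z < m.
  move=> zD rz; rewrite ltnNge; apply: contra p0D => mz; apply: dD zD _ _.
    by rewrite x0.
  by rewrite y0.
have xp : gx p = r.+1.
  apply: (col_top_points far em xym _ (area p pD) ptop).
  by rewrite ltnNge; apply/negP => h; have := ylt p pD; lia.
have yp : gy p = m.-1 by have := ylt p pD; lia.
have inD z : gx z <= r.+1 -> gy z < m -> z \in D by move=> zx zy; apply: dD pD _ _; lia.
(* The missing end of row m slides along the antidiagonals into column r + 1. *)
have slide (z : grid m) : exists z' : grid m,
    z \in rect m r m :\: D -> gx z' = r.+1 /\ gy z' + r.+1 = gx z + m.
  have [zD|] := boolP (z \in rect m r m :\: D); last by exists z.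
  have [xz yz] := grid_range z.
  move: zD; rewrite !inE => /andP[zD /andP[zr _]].
  have [z' [xz' yz']] := @exists_point m r.+1 (gx z + m - r.+1) ltac:(lia) ltac:(lia).
  by exists z' => _; rewrite xz' yz'; lia.
have [phi phiP] := fin_all_exists slide.
have missing z : z \in rect m r m :\: D -> gx z <= r /\ gy z = m.
  rewrite !inE => /andP[zD /andP[zr _]]; split=> //; have [xz yz] := grid_range z.
  by apply/eqP; rewrite eqn_leq yz leqNgt; apply: contra zD => h; apply: inD; lia.
rewrite sC; apply: (exchange_le (phi := phi) q0 cD).
- move=> z z' zD zD' ez; have [_ h] := phiP z zD; have [_ h'] := phiP z' zD'.
  have [_ yz] := missing z zD; have [_ yz'] := missing z' zD'.
  by apply: grid_eq; rewrite ?yz ?yz' //; rewrite ez in h; lia.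
- move=> z zD; have [h1 h2] := phiP z zD; have [xz yz] := missing z zD.
  have [xz0 yz0] := grid_range z.
  rewrite !inE /wt h1; split; last by lia.
  by apply/andP; split; [lia|apply: inD; lia].
apply: graded => [_ /imsetP[z zD ->]|_ z' /imsetP[z zD ->] zD' xz' yz'].
  have [h1 h2] := phiP z zD; split=> //; have [] := grid_range z; lia.
have [h1 h2] := phiP z zD; have [xz yz] := missing z zD.
have ly := ylt z' zD' ltac:(lia).
have [w [xw yw]] := @exists_point m (gy z' + r.+1 - m) m ltac:(have [] := grid_range z; lia) ltac:(lia).
have wD : w \in rect m r m :\: D.
  rewrite !inE xw yw leqnn; apply/andP; split; last by lia.
  move: zD; rewrite !inE => /andP[zD _]; apply: contra zD => wD; apply: dD wD _ _; lia.
apply/imsetP; exists w => //; have [h3 h4] := phiP w wD.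
by apply: grid_eq; lia.
Qed.

Local Open Scope ring_scope.

(** * Krull dimensions and the threshold *)

Lemma krull_dim_le m (U : {set grid m}) (c : nat) :
  (forall p, p \in grid_of U -> (wt p <= c)%N) -> krull_dim U <= c%:Z.
Proof.
move=> Uc; suff : (size (gpoly U) <= c.+1)%N by rewrite /krull_dim; lia.
apply: leq_trans (size_sum _ _ _) _; apply/bigmax_leqP => p /Uc.
by rewrite size_polyXn.
Qed.

Lemma krull_dim_ge m (U : {set grid m}) p :
  p \in grid_of U -> (wt p)%:Z <= krull_dim U.
Proof.
move=> pU; suff : (wt p < size (gpoly U))%N by rewrite /krull_dim; lia.
rewrite ltnNge; apply/negP => /leq_sizeP/(_ _ (leqnn _))/eqP.
rewrite coef_sum (eq_bigr (fun p' => (wt p == wt p')%:R)) => [|p' _]; last by rewrite coefXn.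
rewrite psumr_eq0 => [/allP/(_ p (mem_index_enum _))|p' _]; last exact: ler0n.
by rewrite pU eqxx.
Qed.

Lemma max_krull_dim_le k m K (c : nat) :
  (forall D : {set grid m}, down_closed D -> #|D| = K -> forall p, p \in D -> (wt p <= c)%N) ->
  max_krull_dim k m K <= c%:Z.
Proof.
move=> H; apply: bigmax_le => // U /eqP; rewrite spanning_dimE => cU.
by apply: krull_dim_le; apply: H cU => //; apply: grid_of_down_closed.
Qed.

Lemma max_krull_dim_ge k m (D : {set grid m}) p : down_closed D -> p \in D ->
  (wt p)%:Z <= max_krull_dim k m #|D|.
Proof.
move=> dD pD; have gD := grid_of_id dD.
apply: le_trans (krull_dim_ge (U := D) _) _; first by rewrite gD.
by apply: le_bigmax_cond; rewrite spanning_dimE gD.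
Qed.

Lemma eventually_max k m (C U : {set grid m}) :
  grid_of U = C ->
  (forall (D : {set grid m}) q, down_closed D -> #|D| = #|C| -> (#|D| <= q)%N -> (0 < q)%N ->
     (points q D <= points q C)%N) ->
  eventually_max_points k #|C| U.
Proof.
move=> gU H; exists (maxn 1 #|C|) => F; rewrite geq_max => /andP[q0 qC] V.
rewrite spanning_dimE => cV; rewrite !num_pointsE gU.
by apply: H => //; [apply: grid_of_down_closed|rewrite cV].
Qed.

Unset Implicit Arguments.

Theorem proposition5p9 (k : fieldType) (m K : nat)
    (hm : (3 <= m)%N) (hK : (K <= 'C(m, 2))%N) :
  (6 / 5 * m%:R - 1 < (max_krull_dim k m K)%:~R :> rat ->
     (exists U : {set grid m}, has_minimal_M k K U) /\
     (forall U : {set grid m},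
        has_minimal_M k K U -> eventually_max_points k K U)) /\
  ((max_krull_dim k m K)%:~R <= 6 / 5 * m%:R - 5 :> rat ->
     (exists U : {set grid m}, has_maximal_M k K U) /\
     (forall U : {set grid m},
        has_maximal_M k K U -> eventually_max_points k K U)).
Proof.
have m0 : (0 < m)%N by lia.
split=> hd.
  have [a [e [eK ea am em]]] := row_decomposition m0 hK.
  have [cC _] := row_filledE ea am em.
  have cR := @card_rect m a a.+1 ltac:(lia).
  have cK : #|row_filled m a e| = K by lia.
  have [minC uniqC] := minimal_M_row_initial k
    (row_filled_down_closed (leqW ea)) (row_filled_initial (e := e)) cK.
  split=> [|U minU]; first by exists (row_filled m a e).
  have gU := uniqC U minU; rewrite -cK; apply: (eventually_max k gU) => D q dD cD.
  apply: row_filled_max => //; last by rewrite cD.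
  rewrite leqNgt; apply/negP => far.
  (* If the top level of the row-filled grid were below the threshold, every set
     of K points would stay below it. *)
  suff : max_krull_dim k m K <= ((6 * m - 5) %/ 5)%N%:Z.
    move=> hc; have {}hd : 6 * m%:Z < 5 * max_krull_dim k m K + 5.
      by rewrite -(ltr_int rat) rmorphD !rmorphM !rmorph_nat /= -[m%:Z%:~R]/(m%:R : rat); lra.
    lia.
  apply: max_krull_dim_le => E dE cE p pE; rewrite leqNgt; apply/negP => pfar.
  have [xy ym] := grid_range p; rewrite /wt in pfar.
  have area := area_le dE pE.
  have := @row_top_bound m a e (gx p) (gy p) ea ltac:(lia) ltac:(lia) ltac:(lia); lia.
have [r [e [rm rem eK rem']]] := col_decomposition m0 hK.
have [cC _] := col_filledE rem.
have cR := @card_rect m r m ltac:(lia).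
have cK : #|col_filled m r e| = K by lia.
have dC := col_filled_down_closed rem.
have [maxC uniqC] := maximal_M_col_initial k dC (col_filled_initial (e := e)) cK.
split=> [|U maxU]; first by exists (col_filled m r e).
have gU := uniqC U maxU; rewrite -cK; apply: (eventually_max k gU) => D q dD cD.
have far : (0 < r)%N -> (5 * (r + m) + 10 <= 6 * m)%N.
  move=> r0; have [p [xp yp]] := @exists_point m r m ltac:(lia) ltac:(lia).
  have pC : p \in col_filled m r e by rewrite !inE xp yp !leqnn.
  have := max_krull_dim_ge k dC pC; rewrite cK /wt xp yp => hge.
  have {}hd : 5 * max_krull_dim k m K + 25 <= 6 * m%:Z.
    by rewrite -(ler_int rat) rmorphD !rmorphM !rmorph_nat /= -[m%:Z%:~R]/(m%:R : rat); lra.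
  lia.
by apply: col_filled_max; rewrite ?cD //; lia.
Qed.
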